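(* Let $n\ge2$, $0<\epsilon<1$, $0<\delta<1$, and let $A$ be any distribution on $\{1,\dots,n\}$. Draw $m$ i.i.d. samples from $A$ and let $\hat A_i=X_i/m$, where $X_i$ is the number of samples equal to $i$. (i) If $1\le p\le2$ with Hölder conjugate $q$ and \[ m=\frac1\delta\begin{cases}\dfrac{n}{(n^{1/q}\epsilon)^2} & n\le\left(\frac2\epsilon\right)^q,\\[1em] \dfrac14\left(\frac2\epsilon\right)^q & n\ge\left(\frac2\epsilon\right)^q,\end{cases}\] then $\|\hat A-A\|_p\le\epsilon$ with probability at least $1-\delta$. (ii) If $p\ge2$ (including $p=\infty$) and $m=\frac1\delta\frac1{\epsilon^2}$, then $\|\hat A-A\|_p\le\epsilon$ with probability at least $1-\delta$.
   Context: A distribution on $\{1,\dots,n\}$ is a vector $A\in\mathbb{R}^n$, $A_i\ge0$, $\sum_iA_i=1$; $\|V\|_p=(\sum_i|V_i|^p)^{1/p}$, $\|V\|_\infty=\max_i|V_i|$. Hölder conjugate: $q=p/(p-1)$ for $1<p\le2$, $q=\infty$ for $p=1$; when $q=\infty$, $n^{1/q}=1$ and $(2/\epsilon)^q=\infty$, so the first case applies for all $n$. *)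

(* Defs.v *)
From HB Require Import structures.
From mathcomp Require Import all_boot all_order all_algebra.
From mathcomp Require Import all_classical all_reals all_analysis.

Set Implicit Arguments.
Unset Strict Implicit.
Unset Printing Implicit Defensive.

Import Order.TTheory GRing.Theory Num.Theory.

Local Open Scope classical_set_scope.
Local Open Scope ring_scope.

Definition is_distribution (R : realType) (n : nat) (A : 'rV[R]_n) : Prop :=
  (forall i, 0 <= A ord0 i) /\ \sum_(i < n) A ord0 i = 1.

(* Only exponents 1 <= p <= +oo are meaningful; the value at -oo is junk. *)
Definition lpnorm (R : realType) (n : nat) (p : \bar R) (V : 'rV[R]_n) : R :=
  match p with
  | r%:E => (\sum_(i < n) `|V ord0 i| `^ r) `^ r^-1
  | +oo%E => \big[Num.max/0]_(i < n) `|V ord0 i|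
  | -oo%E => 0
  end.

(* 'I_n is not a measurableType for a variable n ('I_0 is not pointed), so
   random elements of 'I_n are plain functions T -> 'I_n that are measurable
   for the discrete sigma-algebra. *)
Definition measurable_sample (d : measure_display) (T : measurableType d)
    (n : nat) (X : T -> 'I_n) : Prop :=
  forall B : set 'I_n, measurable (X @^-1` B).

Definition mutually_independent (R : realType) (d : measure_display)
    (T : measurableType d) (P : probability T R) (n m : nat)
    (X : 'I_m -> T -> 'I_n) : Prop :=
  forall (J : {set 'I_m}) (B : 'I_m -> set 'I_n),
    P (\bigcap_(j in [set` J]) (X j @^-1` B j)) =
    (\prod_(j in J) P (X j @^-1` B j))%E.

Definition iid_samples (R : realType) (d : measure_display)
    (T : measurableType d) (P : probability T R) (n m : nat) (A : 'rV[R]_n)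
    (X : 'I_m -> T -> 'I_n) : Prop :=
  [/\ forall j, measurable_sample (X j),
      mutually_independent P X &
      forall j i, P (X j @^-1` [set i]) = (A ord0 i)%:E].

Definition empirical (R : realType) (n m : nat) (x : 'I_m -> 'I_n) : 'rV[R]_n :=
  \row_(i < n) (#|[set j | x j == i]%SET|%:R / m%:R).

(* q is meant to be the conjugate exponent of some 1 <= p <= 2, so that
   2 <= q <= +oo. At q = +oo, n^(1/q) = 1 and (2/eps)^q = +oo, so the first
   formula applies for all n; the value at -oo is junk. *)
Definition learning_factor (R : realType) (n : nat) (eps : R) (q : \bar R) : R :=
  match q with
  | r%:E => if n%:R <= (2 / eps) `^ r
            then n%:R / (n%:R `^ r^-1 * eps) ^+ 2
            else 4^-1 * (2 / eps) `^ r
  | +oo%E => n%:R / eps ^+ 2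
  | -oo%E => 0
  end.

(* Main.v *)
(* The squared l2 deviation of the empirical distribution has mean
   sum_i A_i (1 - A_i) / m <= 1/m, so by Markov's inequality it is at most
   1/(delta m) outside an event of probability delta. The rest is deterministic,
   with V the deviation vector:
   - for p >= 2, |V|_p <= |V|_2;
   - for p <= 2, |V|_p^2 <= n^(2/p - 1) |V|_2^2 by Hoelder against the constant 1;
   - for 1 < p <= 2, interpolating between l1 and l2,
     |V|_p^p <= |V|_1^(2 - p) |V|_2^(2 (p - 1)) <= 2^(2 - p) |V|_2^(2 (p - 1)),
     which does not depend on n. *)

Require Import Defs.
From mathcomp Require Import all_boot all_order all_algebra.
From mathcomp Require Import all_classical all_reals all_analysis.
From mathcomp Require Import ring lra.

Set Implicit Arguments.
Unset Strict Implicit.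
Unset Printing Implicit Defensive.

Import Order.TTheory GRing.Theory Num.Theory.
Local Open Scope classical_set_scope.
Local Open Scope ring_scope.

(** * Hölder's inequality and second moments of finite sums *)

(** Normalise both families to total 1 and sum Young's inequality with exponents 1/s and 1/(1 -
    s). *)
Lemma hoelder_sum_powR (R : realType) (I : finType) (f g : I -> R) (s : R) :
  (forall i, 0 <= f i) -> (forall i, 0 <= g i) -> 0 < s -> s <= 1 ->
  \sum_i f i `^ s * g i `^ (1 - s) <=
    (\sum_i f i) `^ s * (\sum_i g i) `^ (1 - s).
Proof.
move=> f0 g0 s0 s1.
(* At s = 1 the second Young exponent degenerates. *)
have [->|s_neq1] := eqVneq s 1.
  rewrite subrr powRr0 mulr1 powRr1 ?sumr_ge0//.
  by apply: ler_sum => i _; rewrite powRr0 mulr1 powRr1.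
have t0 : 0 < 1 - s by rewrite subr_gt0 lt_neqAle s_neq1.
set F := \sum_i f i; set G := \sum_i g i.
have F0 : 0 <= F by exact: sumr_ge0.
have G0 : 0 <= G by exact: sumr_ge0.
have fF i : f i <= F by rewrite /F (bigD1 i)//= lerDl sumr_ge0.
have gG i : g i <= G by rewrite /G (bigD1 i)//= lerDl sumr_ge0.
have [F_eq0|F_neq0] := eqVneq F 0.
  rewrite big1 ?mulr_ge0 ?powR_ge0// => i _.
  have -> : f i = 0 by apply/le_anti; rewrite f0 -F_eq0 fF.
  by rewrite powR0 ?mul0r// gt_eqF.
have [G_eq0|G_neq0] := eqVneq G 0.
  rewrite big1 ?mulr_ge0 ?powR_ge0// => i _.
  have -> : g i = 0 by apply/le_anti; rewrite g0 -G_eq0 gG.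
  by rewrite powR0 ?mulr0// gt_eqF.
have Fgt0 : 0 < F by rewrite lt_neqAle eq_sym F_neq0.
have Ggt0 : 0 < G by rewrite lt_neqAle eq_sym G_neq0.
(* Summed over i, the weighted mean on the right becomes s + (1 - s) = 1. *)
have young i : f i `^ s * g i `^ (1 - s) <=
    F `^ s * G `^ (1 - s) * (s * (f i / F) + (1 - s) * (g i / G)).
  have fE : f i `^ s = F `^ s * (f i / F) `^ s.
    by rewrite -powRM ?divr_ge0// mulrC divfK.
  have gE : g i `^ (1 - s) = G `^ (1 - s) * (g i / G) `^ (1 - s).
    by rewrite -powRM ?divr_ge0// mulrC divfK.
  rewrite fE gE mulrACA ler_wpM2l ?mulr_ge0 ?powR_ge0//.
  have := @conjugate_powR R ((f i / F) `^ s) ((g i / G) `^ (1 - s)) s^-1 (1 - s)^-1.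
  rewrite -!powRrM !divff ?gt_eqF// !powRr1 ?divr_ge0// !invrK ![_ * s]mulrC
    ![_ * (1 - s)]mulrC; apply; rewrite ?powR_ge0 ?invr_gt0//.
  by rewrite addrC subrK.
apply: (le_trans (ler_sum _ (fun i _ => young i))).
rewrite -mulr_sumr big_split/= -!mulr_sumr -!mulr_suml -/F -/G !divff//.
by rewrite !mulr1 addrC subrK mulr1.
Qed.

(** For a probability vector [a], this is the variance of a sum of independent centred variables:
    expectation is a sum over outcomes [x] with product weights, and the cross terms vanish. *)
Lemma sum_prod_sqr_sum (R : comNzRingType) (I J : finType) (a Y : J -> R) :
  \sum_j a j = 1 -> \sum_j a j * Y j = 0 ->
  \sum_(x : {ffun I -> J}) (\prod_i a (x i)) * (\sum_i Y (x i)) ^+ 2 =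
  #|I|%:R * \sum_j a j * Y j ^+ 2.
Proof.
move=> a1 aY0.
have cov i k : \sum_(x : {ffun I -> J}) (\prod_l a (x l)) * (Y (x i) * Y (x k)) =
    if i == k then \sum_j a j * Y j ^+ 2 else 0.
  (* Writing the term as one product over coordinates lets the sum over [x] distribute into a
     product of sums over J. *)
  have expand (x : {ffun I -> J}) : (\prod_l a (x l)) * (Y (x i) * Y (x k)) =
      \prod_l (a (x l) * ((if l == i then Y (x l) else 1) *
                          (if l == k then Y (x l) else 1))).
    by rewrite !big_split/= -!big_mkcond/= !big_pred1_eq.
  under eq_bigr do rewrite expand.
  rewrite -(bigA_distr_bigA (fun l j =>
    a j * ((if l == i then Y j else 1) * (if l == k then Y j else 1)))).
  (* If i = k, coordinate i gives the second moment and every other one gives 1; otherwise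
     coordinate i gives the mean, which is 0. *)
  rewrite (bigD1 i)//= eqxx; case: (eqVneq i k) => [<-|ik].
    rewrite [X in _ * X]big1 ?mulr1//= => l li; rewrite -[RHS]a1.
    by apply: eq_bigr => j _; rewrite (negbTE li) !mulr1.
  by under eq_bigr do rewrite mulr1; rewrite aY0 mul0r.
have sqr_sum (x : {ffun I -> J}) :
    (\prod_l a (x l)) * (\sum_i Y (x i)) ^+ 2 =
    \sum_i \sum_k (\prod_l a (x l)) * (Y (x i) * Y (x k)).
  rewrite expr2 mulr_suml mulr_sumr; apply: eq_bigr => i _.
  by rewrite !mulr_sumr.
rewrite (eq_bigr _ (fun x _ => sqr_sum x)).
rewrite exchange_big/= (eq_bigr (fun=> \sum_j a j * Y j ^+ 2)).
  by rewrite sumr_const mulr_natl.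
move=> i _; rewrite exchange_big/= (eq_bigr _ (fun k _ => cov i k)).
by rewrite -big_mkcond/= (eq_bigl (pred1 i)) ?big_pred1_eq// => k; rewrite /= eq_sym.
Qed.

(** * Deviation of the empirical distribution *)

(** Exhibits the deviation as an average of centred indicators, the form needed for the variance
    identity. *)
Lemma empirical_sub (R : realType) (n m : nat) (A : 'rV[R]_n)
    (x : 'I_m -> 'I_n) i : (0 < m)%N ->
  (empirical R x - A) ord0 i =
  (\sum_j ((x j == i)%:R - A ord0 i)) / m%:R.
Proof.
move=> m0; rewrite !mxE big_split/= sumr_const card_ord mulrDl.
rewrite -[(- A ord0 i) *+ m]mulr_natr mulfK ?pnatr_eq0 -?lt0n//; congr (_ / _ + _).
rewrite -sum1_card natr_sum [LHS]big_mkcond/=; apply: eq_bigr => j _.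
by rewrite inE; case: (x j == i).
Qed.

Lemma sum_empirical (R : realType) (n m : nat) (x : 'I_m -> 'I_n) :
  (0 < m)%N -> \sum_i empirical R x ord0 i = 1.
Proof.
move=> m0.
under eq_bigr => i _.
  rewrite -[empirical R x]subr0 empirical_sub//.
  under eq_bigr do rewrite mxE subr0.
  over.
rewrite -mulr_suml exchange_big/= (eq_bigr (fun=> 1)).
  by rewrite sumr_const card_ord divff// pnatr_eq0 -lt0n.
move=> j _; rewrite (bigD1 (x j))//= eqxx big1 ?addr0// => i.
by rewrite eq_sym => /negbTE ->.
Qed.

Lemma l1_empirical_le2 (R : realType) (n m : nat) (A : 'rV[R]_n)
    (x : 'I_m -> 'I_n) : (0 < m)%N -> is_distribution A ->
  \sum_i `|(empirical R x - A) ord0 i| <= 2.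
Proof.
move=> m0 [A0 A1]; rewrite -[2]/(1 + 1) -{1}(@sum_empirical R n m x)// -A1.
rewrite -big_split/=; apply: ler_sum => i _.
have -> : (empirical R x - A) ord0 i = empirical R x ord0 i - A ord0 i.
  by rewrite !mxE.
by rewrite (le_trans (ler_normB _ _))// !ger0_norm// mxE divr_ge0.
Qed.

(** Coordinate i has variance A_i (1 - A_i) / m, at most A_i / m, and the A_i sum to 1. *)
Lemma mean_sqr_empirical (R : realType) (n m : nat) (A : 'rV[R]_n) :
  (0 < m)%N -> is_distribution A ->
  \sum_(x : {ffun 'I_m -> 'I_n})
    (\prod_j A ord0 (x j)) * \sum_i (empirical R x - A) ord0 i ^+ 2 <= m%:R^-1.
Proof.
move=> m0 [A0 A1].
have mn0 : m%:R != 0 :> R by rewrite pnatr_eq0 -lt0n.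
have pick i (f : 'I_n -> R) : \sum_a A ord0 a * ((a == i)%:R * f a) = A ord0 i * f i.
  rewrite (bigD1 i)//= eqxx mul1r big1 ?addr0// => a /negbTE ->.
  by rewrite mul0r mulr0.
under eq_bigr do rewrite mulr_sumr.
rewrite exchange_big/= -[leRHS]mul1r -[X in _ <= X * _]A1 mulr_suml.
apply: ler_sum => i _.
under eq_bigr => x _ do rewrite empirical_sub// expr_div_n mulrA.
rewrite -mulr_suml (@sum_prod_sqr_sum _ _ _ (fun a => A ord0 a)
  (fun a => (a == i)%:R - A ord0 i))//; last first.
  under eq_bigr do rewrite mulrBr -[X in _ * X]mulr1.
  by rewrite sumrB pick -mulr_suml A1 mul1r mulr1 subrr.
(* Bernoulli variance: the square is rearranged to factor out the indicator, so that [pick]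
   applies. *)
have -> : \sum_a A ord0 a * ((a == i)%:R - A ord0 i) ^+ 2 =
    A ord0 i - A ord0 i ^+ 2.
  under eq_bigr => a _.
    have -> : A ord0 a * ((a == i)%:R - A ord0 i) ^+ 2 =
        A ord0 a * ((a == i)%:R * ((a == i)%:R - 2 * A ord0 i)) +
        A ord0 a * A ord0 i ^+ 2 by ring.
    over.
  by rewrite big_split/= pick -mulr_suml A1 eqxx/= mulr1n; ring.
rewrite card_ord [m%:R * _]mulrC expr2 invfM -mulrA mulVKf//.
by rewrite ler_wpM2r ?invr_ge0// gerBl -expr2 sqr_ge0.
Qed.

(** * From the probability space to finite sums *)

(** The event is a finite disjoint union of cylinders, one per outcome satisfying [Q]; independence
    and the common law give each cylinder its product weight. *)
Lemma sample_event (R : realType) (n m : nat) (A : 'rV[R]_n)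
    (d : measure_display) (T : measurableType d) (P : probability T R)
    (X : 'I_m -> T -> 'I_n) (Q : pred ('I_m -> 'I_n)) :
  iid_samples P A X ->
  measurable [set w | Q (fun j => X j w)] /\
  P [set w | Q (fun j => X j w)] =
    (\sum_(x : {ffun 'I_m -> 'I_n} | Q x) \prod_j A ord0 (x j))%:E.
Proof.
move=> [mX indX PX].
pose cyl (x : {ffun 'I_m -> 'I_n}) := \bigcap_(j in [set` [set: 'I_m]%SET])
  (X j @^-1` [set x j]).
pose D := [set` [pred x : {ffun 'I_m -> 'I_n} | Q x]].
have eventE : [set w | Q (fun j => X j w)] = \bigcup_(x in D) cyl x.
  apply/seteqP; split=> [w /= Qw|w [x /= Qx xw]].
    have XE : [ffun j => X j w] = (fun j => X j w) :> ('I_m -> 'I_n).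
      by apply/funext => j; rewrite ffunE.
    exists [ffun j => X j w]; first by rewrite /D/= inE XE.
    by move=> j _ /=; rewrite ffunE.
  have -> : (fun j => X j w) = x; last by [].
  by apply/funext => j; apply: xw; rewrite /= inE.
have mcyl x : measurable (cyl x).
  by apply: fin_bigcap_measurable => // j _; exact: mX.
have finD : finite_set D by exact: finite_finset.
rewrite eventE; split; first by apply: fin_bigcup_measurable.
rewrite measure_fin_bigcup//; last first.
  move=> x y _ _ [w [xw yw]]; apply/ffunP => j.
  by transitivity (X j w); [apply/esym/xw|apply/yw]; rewrite /= inE.
have -> : (\sum_(x \in D) P (cyl x) =
    \sum_(x : {ffun 'I_m -> 'I_n} | Q x) P (cyl x))%E.
  apply/esym/bigfs => [|x _]; first exact: index_enum_uniq.
  by rewrite mem_index_enum.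
rewrite -sumEFin; apply: eq_bigr => x _.
rewrite indX -prodEFin; apply: eq_big => [j|j _]; first by rewrite inE.
exact: PX.
Qed.

(** Markov's inequality on the complement: an outcome violating [Q] has squared deviation above
    1/(delta m), so its weight is at most delta m times its share of the mean, and the mean is at
    most 1/m. *)
Lemma empirical_event_ge (R : realType) (n m : nat) (A : 'rV[R]_n) (delta : R)
    (d : measure_display) (T : measurableType d) (P : probability T R)
    (X : 'I_m -> T -> 'I_n) (Q : pred ('I_m -> 'I_n)) :
  (0 < m)%N -> 0 < delta -> is_distribution A -> iid_samples P A X ->
  (forall x, \sum_i (empirical R x - A) ord0 i ^+ 2 <= (delta * m%:R)^-1 -> Q x) ->
  ((1 - delta)%:E <= P [set w | Q (fun j => X j w)])%E.
Proof.
move=> m0 delta0 dA iidX SQ; have [A0 A1] := dA.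
have [mN PN] := sample_event (predC Q) iidX.
have -> : [set w | Q (fun j => X j w)] = ~` [set w | predC Q (fun j => X j w)].
  by apply/seteqP; split=> w /=; [move=> ->|move=> /negP; rewrite negbK].
rewrite probability_setC// PN -EFinB lee_fin lerB//.
have dm0 : 0 < delta * m%:R by rewrite mulr_gt0// ltr0n.
have -> : delta = delta * m%:R * m%:R^-1 by rewrite mulfK// pnatr_eq0 -lt0n.
apply: le_trans (ler_wpM2l (ltW dm0) (mean_sqr_empirical m0 dA)).
rewrite mulr_sumr big_mkcond/=; apply: ler_sum => x _.
have w0 : 0 <= \prod_j A ord0 (x j) by exact: prodr_ge0.
set S := \sum_i _; have S0 : 0 <= S by apply: sumr_ge0 => i _; exact: sqr_ge0.
case: ifPn => [/negP nQ|_]; last by rewrite !mulr_ge0// ltW.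
rewrite mulrCA ler_peMr// -ler_pdivrMl// mulr1 ltW// ltNge.
by apply/negP => /SQ.
Qed.

(** * Deterministic norm bounds *)

Lemma lpnorm_fin_le (R : realType) (n : nat) (p eps : R) (V : 'rV[R]_n) :
  0 < p -> 0 <= eps ->
  \sum_i `|V ord0 i| `^ p <= eps `^ p -> lpnorm p%:E V <= eps.
Proof.
move=> p0 eps0 H /=.
have -> : eps = (eps `^ p) `^ p^-1 by rewrite -powRrM mulfV ?gt_eqF// powRr1.
rewrite ge0_ler_powR ?nnegrE ?invr_ge0 ?powR_ge0 ?(ltW p0)//.
by apply: sumr_ge0 => i _; exact: powR_ge0.
Qed.

(** Every coordinate is at most eps in absolute value, which settles p = +oo; for finite p it gives
    |V_i|^p <= eps^(p - 2) V_i^2. *)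
Lemma lpnorm_ge2_le (R : realType) (n : nat) (p : \bar R) (eps : R)
    (V : 'rV[R]_n) : (2%:E <= p)%E -> 0 < eps ->
  \sum_i V ord0 i ^+ 2 <= eps ^+ 2 -> lpnorm p V <= eps.
Proof.
move=> p2 eps0 H.
have Vi i : `|V ord0 i| <= eps.
  rewrite -(@ler_pXn2r _ 2)// ?nnegrE ?normr_ge0 ?(ltW eps0)// real_normK ?num_real//.
  by apply: le_trans H; rewrite (bigD1 i)//= lerDl sumr_ge0// => j _; exact: sqr_ge0.
case: p p2 => [p||] p2.
- rewrite lee_fin in p2; apply: lpnorm_fin_le; rewrite ?(lt_le_trans _ p2)// ?(ltW eps0)//.
  have split_pow x : 0 <= x -> x `^ p = x `^ (p - 2) * x ^+ 2.
    move=> x0; rewrite -powR_mulrn// -powRD ?subrK//.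
    by rewrite (gt_eqF (lt_le_trans _ p2)).
  rewrite (split_pow eps) ?(ltW eps0)//.
  apply: le_trans (ler_wpM2l (powR_ge0 _ _) H); rewrite mulr_sumr.
  apply: ler_sum => i _; rewrite split_pow// real_normK ?num_real//.
  by rewrite ler_wpM2r ?sqr_ge0// ge0_ler_powR ?nnegrE ?subr_ge0 ?(ltW eps0).
- by apply/bigmax_leP; split=> //; exact: ltW.
- by [].
Qed.

Lemma hoelder_conjugate_gt1 (R : realType) (p : R) : 1 < p ->
  hoelder_conjugate p%:E = (p / (p - 1))%:E.
Proof.
move=> p1; rewrite /hoelder_conjugate/= eqe gt_eqF ?(lt_trans ltr01)//.
by rewrite -EFinB inver subr_eq0 gt_eqF.
Qed.

Lemma sqr_powR_half (R : realType) (x p : R) : (x ^+ 2) `^ (p / 2) = `|x| `^ p.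
Proof.
by rewrite -real_normK ?num_real// -powR_mulrn// -powRrM mulrCA mulfV ?mulr1 ?pnatr_eq0.
Qed.

Lemma lpnorm_le2_le_dim (R : realType) (n : nat) (p eps : R) (V : 'rV[R]_n) :
  (0 < n)%N -> 0 < p -> p <= 2 -> 0 < eps ->
  \sum_i V ord0 i ^+ 2 <= eps ^+ 2 * n%:R `^ (1 - 2 / p) ->
  lpnorm p%:E V <= eps.
Proof.
move=> n0 p0 p2 eps0 H; apply: lpnorm_fin_le => //; first exact: ltW.
have h0 : 0 < p / 2 by rewrite divr_gt0.
have := @hoelder_sum_powR R 'I_n (fun i => V ord0 i ^+ 2) (fun=> 1) (p / 2)
  (fun i => sqr_ge0 _) (fun i => ler01) h0.
rewrite ler_pdivrMr// mul1r sumr_const card_ord => /(_ p2).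
under eq_bigr do rewrite sqr_powR_half powR1 mulr1.
move=> /le_trans; apply.
have nN0 : n%:R != 0 :> R by rewrite pnatr_eq0 -lt0n.
have S0 : 0 <= \sum_i V ord0 i ^+ 2 by apply: sumr_ge0 => i _; exact: sqr_ge0.
have Hpow : (\sum_i V ord0 i ^+ 2) `^ (p / 2) <=
    (eps ^+ 2 * n%:R `^ (1 - 2 / p)) `^ (p / 2).
  by rewrite ge0_ler_powR ?nnegrE ?(ltW h0) ?mulr_ge0 ?powR_ge0 ?(ltW eps0).
apply: (le_trans (ler_wpM2r (powR_ge0 _ _) Hpow)).
rewrite powRM ?sqr_ge0 ?powR_ge0// sqr_powR_half gtr0_norm// -mulrA -powRrM.
rewrite -powRD ?nN0 ?implybT//.
(* The power of n in the hypothesis exactly cancels the Hölder factor n^(1 - p/2). *)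
have -> : (1 - 2 / p) * (p / 2) + (1 - p / 2) = 0 by field; rewrite gt_eqF.
by rewrite powRr0 mulr1.
Qed.

(** Hölder with weights 2 - p and p - 1 on |V_i| and V_i^2. With q = p/(p - 1), the bound 4 /
    (2/eps)^q raised to p - 1 is 4^(p - 1) (eps/2)^p, and the factor 2^(2 - p) turns this into
    eps^p. *)
Lemma lpnorm_le2_le_l1 (R : realType) (n : nat) (p eps : R) (V : 'rV[R]_n) :
  1 < p -> p <= 2 -> 0 < eps -> \sum_i `|V ord0 i| <= 2 ->
  \sum_i V ord0 i ^+ 2 <= 4 / (2 / eps) `^ (p / (p - 1)) ->
  lpnorm p%:E V <= eps.
Proof.
move=> p1 p2 eps0 H1 H2.
have p0 : 0 < p by exact: lt_trans p1.
apply: lpnorm_fin_le => //; first exact: ltW.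
have q0 : 0 < p - 1 by rewrite subr_gt0.
(* At p = 2 the Hölder weight 2 - p would be 0; there the hypothesis already reads as the claim. *)
have := p2; rewrite le_eqVlt => /predU1P[p_eq2|p_lt2].
  move: H2; rewrite p_eq2.
  under [in X in _ -> X]eq_bigr do rewrite powR_mulrn// real_normK ?num_real//.
  move=> /le_trans; apply.
  have -> : 2 / (2 - 1) = 2%:R :> R by field.
  rewrite !powR_mulrn ?divr_ge0 ?(ltW eps0)//.
  by have -> : 4 / (2 / eps) ^+ 2 = eps ^+ 2 by field; rewrite gt_eqF.
have s0 : 0 < 2 - p by rewrite subr_gt0.
have s1 : 2 - p <= 1 by lra.
have := @hoelder_sum_powR R 'I_n (fun i => `|V ord0 i|) (fun i => V ord0 i ^+ 2) (2 - p)
  (fun i => normr_ge0 _) (fun i => sqr_ge0 _) s0 s1.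
have -> : 1 - (2 - p) = p - 1 by ring.
have termE i : `|V ord0 i| `^ (2 - p) * (V ord0 i ^+ 2) `^ (p - 1) = `|V ord0 i| `^ p.
  have -> : p - 1 = (2 * (p - 1)) / 2 by field.
  rewrite sqr_powR_half -powRD; first by congr (_ `^ _); ring.
  by apply/implyP => /eqP; lra.
rewrite (eq_bigr _ (fun i _ => termE i)) => /le_trans; apply.
have S0 : 0 <= \sum_i V ord0 i ^+ 2 by apply: sumr_ge0 => i _; exact: sqr_ge0.
have q_ge0 := ltW q0; have e2 : 0 < 2 / eps by rewrite divr_gt0.
apply: (@le_trans _ _ (2 `^ (2 - p) * (4 / (2 / eps) `^ (p / (p - 1))) `^ (p - 1))).
  rewrite ler_pM ?powR_ge0// ge0_ler_powR// ?nnegrE ?sumr_ge0 ?ltW//.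
  by rewrite divr_gt0// powR_gt0.
rewrite powRM ?invr_ge0 ?powR_ge0// -powRN -powRrM.
have -> : - (p / (p - 1)) * (p - 1) = - p by field; rewrite gt_eqF.
have -> : 4 = 2 `^ 2 :> R by rewrite powR_mulrn// -natrX.
rewrite -powRrM mulrA -powRD ?pnatr_eq0 ?implybT//.
have -> : 2 - p + 2 * (p - 1) = p by ring.
rewrite -[- p]mulN1r [(2 / eps) `^ _]powRrM powR_inv1 ?(ltW e2)// invf_div.
by rewrite -powRM ?divr_ge0 ?(ltW eps0)// mulrC divfK ?pnatr_eq0.
Qed.

(** * Sample sizes *)

Unset Implicit Arguments.

(** The prescribed sample size need not be an integer, so it enters as a lower bound on [m]. *)
Theorem theorem8 (R : realType) (n : nat) (eps delta : R) (A : 'rV[R]_n)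
    (d : measure_display) (T : measurableType d) (P : probability T R)
    (m : nat) (X : 'I_m -> T -> 'I_n) :
  (2 <= n)%N -> 0 < eps -> eps < 1 -> 0 < delta -> delta < 1 ->
  is_distribution A -> iid_samples P A X ->
  (forall p : R, 1 <= p -> p <= 2 ->
     delta^-1 * learning_factor n eps (hoelder_conjugate p%:E) <= m%:R ->
     ((1 - delta)%:E <=
        P [set w | (lpnorm p%:E (empirical R (fun j => X j w) - A) <= eps)%R])%E)
  /\
  (forall p : \bar R, (2%:E <= p)%E ->
     delta^-1 * (eps ^+ 2)^-1 <= m%:R ->
     ((1 - delta)%:E <=
        P [set w | (lpnorm p (empirical R (fun j => X j w) - A) <= eps)%R])%E).
Proof.
move=> n2 eps0 _ delta0 _ dA iidX.
have ngt0 : (0 < n)%N by exact: ltnW.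
have nR0 : 0 < n%:R :> R by rewrite ltr0n.
(* Here [c] is the sample size without its factor 1/delta: m >= c/delta gives 1/(delta m) <= 1/c,
   leaving a deterministic norm bound. *)
have deviation (p : \bar R) (c : R) : 0 < c -> delta^-1 * c <= m%:R ->
    (forall V : 'rV[R]_n, \sum_i `|V ord0 i| <= 2 ->
       \sum_i V ord0 i ^+ 2 <= c^-1 -> lpnorm p V <= eps) ->
    ((1 - delta)%:E <=
       P [set w | (lpnorm p (empirical R (fun j => X j w) - A) <= eps)%R])%E.
  move=> c0 mc HV.
  have dc0 : 0 < delta^-1 * c by rewrite mulr_gt0 ?invr_gt0.
  have m0 : (0 < m)%N by rewrite -(@ltr0n R); exact: lt_le_trans mc.
  apply: (empirical_event_ge (delta := delta)
    (Q := fun x => lpnorm p (empirical R x - A) <= eps) _ _ dA iidX) => // x Sx.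
  apply: HV; first exact: l1_empirical_le2.
  apply: le_trans Sx _; rewrite lef_pV2 ?posrE ?mulr_gt0 ?ltr0n//.
  by rewrite -ler_pdivrMl.
split=> [p p1 p2|p p2 mc]; last first.
  apply: deviation mc _; first by rewrite invr_gt0 exprn_gt0.
  by move=> V _; rewrite invrK; exact: lpnorm_ge2_le.
have p0 : 0 < p by exact: lt_le_trans p1.
(* Since 1 - 2/q = 2/p - 1, this [c] is n / (n^(1/q) eps)^2. *)
have dim_case (c : R) : c = n%:R `^ (2 / p - 1) / eps ^+ 2 ->
    delta^-1 * c <= m%:R ->
    ((1 - delta)%:E <=
       P [set w | (lpnorm p%:E (empirical R (fun j => X j w) - A) <= eps)%R])%E.
  move=> cE mc; apply: deviation mc _.
    by rewrite cE divr_gt0 ?powR_gt0 ?exprn_gt0.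
  move=> V _; rewrite cE invf_div -powRN opprB.
  exact: lpnorm_le2_le_dim.
(* At p = 1, q = +oo and the exponent 2/p - 1 is 1, matching n / eps^2. *)
have [p_eq1|p_neq1] := eqVneq p 1.
  rewrite {1}p_eq1 hoelder_conjugate1 /learning_factor.
  by apply: dim_case; rewrite p_eq1 divr1 (_ : 2 - 1 = 1) ?powRr1//; ring.
have pgt1 : 1 < p by rewrite lt_neqAle eq_sym p_neq1.
have pm1 : p - 1 != 0 by rewrite subr_eq0.
rewrite hoelder_conjugate_gt1// /learning_factor; case: ifPn => _.
  apply: dim_case.
  rewrite exprMn -[(_ `^ _) ^+ 2]powR_mulrn ?powR_ge0// -powRrM invfM mulrA; congr (_ / _).
  rewrite -{1}(powRr1 (ltW nR0)) -powRN -powRD ?(gt_eqF nR0) ?implybT//.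
  by congr (_ `^ _); field; rewrite pm1 gt_eqF.
have r0 : 0 < (2 / eps) `^ (p / (p - 1)) by rewrite powR_gt0 ?divr_gt0.
move=> mc; apply: deviation mc _; first by rewrite mulr_gt0.
by move=> V V1; rewrite invfM invrK; exact: lpnorm_le2_le_l1.
Qed.
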